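(* Let $\sigma=(E,\#,\to,\mathrm{Drop})$ be an SES and let $\mathrm{des}(\sigma)=(E,\#,\mapsto)$ be the DES whose bundles are given by: $S\mapsto y$ iff $S\subseteq E$, $y\in E$, and there is $x\in E$ with $x\to y$ and $S=\{x\}\cup\{d\in E\mid (d,x,y)\in\mathrm{Drop}\}$. Then $\sigma$ and $\mathrm{des}(\sigma)$ have the same set of posets.
   Context: An SES is a tuple $\sigma=(E,\#,\to,\mathrm{Drop})$: $E$ a set of events, $\#\subseteq E^2$ irreflexive and symmetric, $\to\subseteq E^2$, $\mathrm{Drop}\subseteq E^3$ with $(d,c,t)\in\mathrm{Drop}$ implying $c\to t$ and $d\notin\{c,t\}$. Let $\mathrm{ic}(e)=\{e'\mid e'\to e\}$ and $\mathrm{dc}(H,e)=\{e'\mid\exists d\in H.(d,e',e)\in\mathrm{Drop}\}$. For $t=e_1\cdots e_n$ write $\overline t=\{e_1,\dots,e_n\}$, $t_i=e_1\cdots e_i$. A trace of $\sigma$ is a sequence of pairwise distinct events of $E$ with no two in conflict and $\mathrm{ic}(e_i)\setminus\mathrm{dc}(\overline{t_{i-1}},e_i)\subseteq\overline{t_{i-1}}$ for all $i$. A DES is $\delta=(E,\#,\mapsto)$ with $\#$ irreflexive symmetric on $E$ and $\mapsto\subseteq\mathcal P(E)\times E$ (bundles). A trace of $\delta$ is a sequence of pairwise distinct conflict-free events such that every bundle $X\mapsto e_i$ satisfies $X\cap\overline{t_{i-1}}\ne\emptyset$. Posets (early causality): for a trace $t=e_1\cdots e_n$ and sets $U_1\neq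 U_2$ of events of $t$, $U_1$ is earlier than $U_2$ if the largest index $j$ with $e_j\in U_1\setminus U_2$ is smaller than the largest index $j$ with $e_j\in U_2\setminus U_1$. In a DES, the cause $U_i$ of $e_i$ in $t$ is the earliest set $U\subseteq\overline{t_{i-1}}$ with $U\cap X\neq\emptyset$ for every bundle $X\mapsto e_i$. In an SES, the cause $U_i$ of $e_i$ in $t$ is the earliest set $U\subseteq\overline{t_{i-1}}$ with $\mathrm{ic}(e_i)\setminus\mathrm{dc}(U,e_i)\subseteq U$. The poset of $t$ is $(\overline t,\le)$ where $\le$ is the reflexive transitive closure of $\{(c,e_i)\mid 1\le i\le n,\ c\in U_i\}$. The set of posets of a structure is the set of posets of all its traces. *)

(* Defs.v *)
(* The set of events is a type [E]; sets of events are [Ensemble E]. *)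
From Stdlib Require Import List Ensembles Relations Arith.

Set Implicit Arguments.

Arguments Included {U} B C.
Arguments Setminus {U} B C _.
Arguments Intersection {U} B C _.
Arguments Union {U} B C _.
Arguments Singleton {U} x _.
Arguments Inhabited {U} B.

Record SES (E : Type) : Type := mkSES {
  ses_conflict : relation E;
  ses_cause : relation E;
  ses_drop : E -> E -> E -> Prop;
  ses_conflict_irrefl : forall e, ~ ses_conflict e e;
  ses_conflict_sym : forall e e', ses_conflict e e' -> ses_conflict e' e;
  ses_drop_cause : forall d c t, ses_drop d c t -> ses_cause c t;
  ses_drop_fresh : forall d c t, ses_drop d c t -> d <> c /\ d <> t
}.

Record DES (E : Type) : Type := mkDES {
  des_conflict : relation E;
  des_bundle : Ensemble E -> E -> Prop;
  des_conflict_irrefl : forall e, ~ des_conflict e e;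
  des_conflict_sym : forall e e', des_conflict e e' -> des_conflict e' e
}.

Section Traces.
Variable E : Type.
Implicit Types (t : list E) (U : Ensemble E) (i : nat).

Definition events t : Ensemble E := fun e => List.In e t.

(* Indices are 1-based: [event_at t i e] says that t = e_1 ... e_n, with
   1 <= i <= n and e_i = e. *)
Definition event_at t i (e : E) : Prop :=
  1 <= i /\ nth_error t (i - 1) = Some e.

(* The set of events of t_(i-1) = e_1 ... e_(i-1). *)
Definition before t i : Ensemble E := events (firstn (i - 1) t).

(* [j] is the largest index of an event of [t] in [U]; it is 0, which is below
   every index, when there is no such event. *)
Definition largest_index t U (j : nat) : Prop :=
  (forall i e, event_at t i e -> U e -> i <= j) /\
  (j = 0 \/ exists e, event_at t j e /\ U e).

Definition earlier t (U1 U2 : Ensemble E) : Prop :=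
  exists j1 j2, largest_index t (Setminus U1 U2) j1 /\
                largest_index t (Setminus U2 U1) j2 /\ j1 < j2.

Definition earliest t (P : Ensemble E -> Prop) U : Prop :=
  P U /\ forall U', P U' -> U' <> U -> earlier t U U'.

Definition conflict_free (conflict : relation E) t : Prop :=
  forall e e', List.In e t -> List.In e' t -> ~ conflict e e'.

Record event_poset : Type := mkPoset {
  poset_carrier : Ensemble E;
  poset_le : relation E
}.

(* [cause t i e U] reads: U is the cause U_i of e = e_i in t. The closure is
   restricted to the events of [t], since [clos_refl_trans] is reflexive on
   the whole of [E]. *)
Definition trace_poset (cause : list E -> nat -> E -> Ensemble E -> Prop) t
  : event_poset :=
  mkPoset (events t)
    (fun x y => events t x /\ events t y /\
       clos_refl_trans E
         (fun c e => exists i U, event_at t i e /\ cause t i e U /\ U c) x y).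

Section SESTraces.
Variable s : SES E.

Definition ic (e : E) : Ensemble E := fun e' => ses_cause s e' e.

Definition dc (H : Ensemble E) (e : E) : Ensemble E :=
  fun e' => exists d, H d /\ ses_drop s d e' e.

Definition ses_trace t : Prop :=
  NoDup t /\ conflict_free (ses_conflict s) t /\
  forall i e, event_at t i e ->
    Included (Setminus (ic e) (dc (before t i) e)) (before t i).

Definition ses_cause_in t i (e : E) U : Prop :=
  earliest t (fun V => Included V (before t i) /\
                       Included (Setminus (ic e) (dc V e)) V) U.

Definition ses_posets : Ensemble event_poset :=
  fun p => exists t, ses_trace t /\ p = trace_poset ses_cause_in t.
End SESTraces.

Section DESTraces.
Variable d : DES E.

Definition des_trace t : Prop :=
  NoDup t /\ conflict_free (des_conflict d) t /\
  forall i e, event_at t i e ->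
    forall X, des_bundle d X e -> Inhabited (Intersection X (before t i)).

Definition des_cause_in t i (e : E) U : Prop :=
  earliest t (fun V => Included V (before t i) /\
                       forall X, des_bundle d X e ->
                                 Inhabited (Intersection V X)) U.

Definition des_posets : Ensemble event_poset :=
  fun p => exists t, des_trace t /\ p = trace_poset des_cause_in t.
End DESTraces.
End Traces.

Definition des_of_ses (E : Type) (s : SES E) : DES E :=
  mkDES (ses_conflict s)
    (fun S y => exists x, ses_cause s x y /\
       S = Union (Singleton x) (fun d => ses_drop s d x y))
    (ses_conflict_irrefl s) (ses_conflict_sym s).

(* Main.v *)
(** A set [V] enables [e] in an SES iff every initial cause [x] of [e] lies in
    [V] or is dropped by an event of [V], that is, iff [V] meets the bundle
    made of [x] and of its droppers. So a structure and its translation have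
    the same traces, and select the cause of an event among the same sets. *)
From Stdlib Require Import Ensembles List Classical.
From Stdlib Require Import FunctionalExtensionality PropExtensionality.
Require Import Defs.

Lemma enabled_iff_meets_bundles (E : Type) (s : SES E) (e : E) (V : Ensemble E) :
  Included (Setminus (ic s e) (dc s V e)) V <->
  forall X, des_bundle (des_of_ses s) X e -> Inhabited (Intersection V X).
Proof.
  split.
  - intros Hincl X [x [Hx ->]].
    (* Excluded middle picks the witness: a dropper of [x] in [V] if there is one, else [x] itself,
       which must then lie in [V]. *)
    destruct (classic (dc s V e x)) as [[d [Hd Hdrop]] | Hnd].
    + exists d; split; [exact Hd | right; exact Hdrop].
    + exists x; split; [apply Hincl; split; assumption | left; constructor].
  - intros Hmeet x [Hx Hnd].
    destruct (Hmeet _ (ex_intro _ x (conj Hx eq_refl))) as [d Hd].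
    destruct Hd as [d HV HX]; destruct HX as [d Hd | d Hdrop].
    + destruct Hd; exact HV.
    + destruct Hnd; exists d; split; assumption.
Qed.

(** Bridges [des_trace], where the bundle is the left factor, and [des_cause_in], where it is the
    right one. *)
Lemma Inhabited_Intersection_comm (E : Type) (A B : Ensemble E) :
  Inhabited (Intersection A B) -> Inhabited (Intersection B A).
Proof. intros [x [y HA HB]]; exists y; split; assumption. Qed.

Lemma des_of_ses_trace (E : Type) (s : SES E) (t : list E) :
  des_trace (des_of_ses s) t <-> ses_trace s t.
Proof.
  split; intros (Hnodup & Hconf & H); split; [exact Hnodup | | exact Hnodup |];
    (split; [exact Hconf |]).
  - intros i e Hi; apply enabled_iff_meets_bundles.
    intros X HX; apply Inhabited_Intersection_comm; exact (H i e Hi X HX).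
  - intros i e Hi X HX; apply Inhabited_Intersection_comm.
    exact (proj1 (enabled_iff_meets_bundles _ _ _ _) (H i e Hi) X HX).
Qed.

(** An equality of functions, to rewrite inside [trace_poset]. As [earlier] depends only on the
    trace, comparing the candidate sets suffices. *)
Lemma des_of_ses_cause_in (E : Type) (s : SES E) :
  des_cause_in (des_of_ses s) = ses_cause_in s.
Proof.
  extensionality t; extensionality i; extensionality e; extensionality U.
  unfold des_cause_in, ses_cause_in; f_equal; extensionality V.
  apply propositional_extensionality; rewrite enabled_iff_meets_bundles; reflexivity.
Qed.

Theorem theorem4p9 (E : Type) (s : SES E) :
  ses_posets s = des_posets (des_of_ses s).
Proof.
  extensionality p; apply propositional_extensionality.
  unfold ses_posets, des_posets; rewrite des_of_ses_cause_in.
  split; intros [t [Ht Hp]]; exists t; (split; [apply des_of_ses_trace |]; assumption).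
Qed.
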